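(* Let $\{(N_k,B_k)\}_{k=1}^\infty$ be a sequence such that, for all $k\in\mathbb{N}$, $N_k\ge M_k\ge2$ are integers and $B_k$ is a complete residue system modulo $M_k$ with character polynomial $$f_{B_k}(x)=\sum_{i=0}^{2n_k}(-x)^i,$$ where $n_k\geq 0$ is an integer with $(4n_k+2)\mid M_k$. Suppose that $\{\nu_{>k}\}_{k=1}^\infty$ is tight. If the infinite convolution $\mu$ of $\{(N_k,B_k)\}_{k=1}^\infty$ is a spectral measure, then $M_k\mid N_k$ for all $k\ge2$.
   Context: $\mathbb{N}=\{1,2,3,\dots\}$. A finite set $B\subset\mathbb{Z}$ is a complete residue system modulo $M\in\mathbb{N}$ if $B\equiv\{0,1,\dots,M-1\}\pmod M$, i.e. $\#B=M$ and each residue class modulo $M$ is represented by exactly one element of $B$. For such $B$ put $b_*=\min B$; the character polynomial of $B$ is $f_B(x)=\dfrac{\sum_{b\in B}x^b}{x^{b_*}\sum_{k=0}^{\#B-1}x^k}$. For a finite nonempty set $A\subset\mathbb{R}$, $\delta_A=\frac1{\#A}\sum_{a\in A}\delta_a$ with $\delta_a$ the Dirac measure at $a$. The infinite convolution $\mu=\delta_{N_1^{-1}B_1}*\delta_{(N_1N_2)^{-1}B_2}*\cdots$ is the weak limit, as $n\to\infty$, of $\delta_{N_1^{-1}B_1}*\cdots*\delta_{(N_1\cdots N_n)^{-1}B_n}$, assumed to exist as a Borel probability measure. The tail measure is $\nu_{>k}=\delta_{N_{k+1}^{-1}B_{k+1}}*\delta_{(N_{k+1}N_{k+2})^{-1}B_{k+2}}*\cdots$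 (also a weak limit of finite convolutions). A family $\Phi$ of Borel probability measures on $\mathbb{R}$ is tight if for each $\epsilon>0$ there is a compact $K\subset\mathbb{R}$ with $\inf_{\eta\in\Phi}\eta(K)>1-\epsilon$. A Borel probability measure $\mu$ on $\mathbb{R}$ is a spectral measure if there is a countable $\Lambda\subseteq\mathbb{R}$ such that $\{e^{-2\pi i\lambda x}:\lambda\in\Lambda\}$ is an orthonormal basis of $L^2(\mu)$. *)

(* Defs.v *)
From HB Require Import structures.
From mathcomp Require Import all_boot all_order all_algebra.
From mathcomp Require Import finmap fraction.
From mathcomp Require Import complex.
From mathcomp Require Import all_classical all_reals all_analysis.

Set Implicit Arguments.
Unset Strict Implicit.
Unset Printing Implicit Defensive.

Import Order.TTheory GRing.Theory Num.Theory.
Import numFieldNormedType.Exports.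

Local Open Scope classical_set_scope.
Local Open Scope ring_scope.

Definition complete_residue_system (B : {fset int}) (M : nat) : Prop :=
  #|` B| = M /\
  forall r : nat, (r < M)%N -> exists! b : int, b \in B /\ (b = r %[mod M])%Z.

(* The default value of the iterated minimum is an element of B as soon as
   B is nonempty. *)
Definition fset_min (B : {fset int}) : int :=
  \big[Num.min/head 0 B]_(b <- B) b.

(* The quotient is taken in the field of rational functions, so that it is
   exact and the exponents b and min B may be negative. *)
Definition character_polynomial (B : {fset int}) : {fraction {poly int}} :=
  let x : {fraction {poly int}} := tofrac 'X in
  (\sum_(b <- B) x ^ b) / (x ^ fset_min B * \sum_(k < #|` B|) x ^+ k).

Section measures.
Context {R : realType}.
Local Notation RM := (measurableTypeR R).
Local Open Scope ereal_scope.

(* The uniform probability on a nonempty A; the zero measure if A is empty. *)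
Definition uniform_on (A : {fset R}) : set RM -> \bar R :=
  fun X => ((#|` A|%:R)^-1)%:E * \sum_(a <- A) \d_(a : RM) X.

Section uniform_on_measure.
Variable A : {fset R}.

Let inv_nng : {nonneg R} := NngNum (ltac:(by rewrite invr_ge0)
  : (0 <= (#|` A|%:R)^-1 :> R)%R).

Let uniform_onE : uniform_on A =
  mscale inv_nng (msum (fun i => \d_(nth 0%R A i : RM)) #|` A|).
Proof.
by apply/funext => X; rewrite /uniform_on /mscale /msum (big_nth 0%R) big_mkord.
Qed.

Let uniform_on0 : uniform_on A set0 = 0.
Proof. by rewrite uniform_onE measure0. Qed.

Let uniform_on_ge0 X : 0 <= uniform_on A X.
Proof. by rewrite uniform_onE. Qed.

Let uniform_on_sigma_additive : semi_sigma_additive (uniform_on A).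
Proof. by rewrite uniform_onE; exact: measure_semi_sigma_additive. Qed.

HB.instance Definition _ := isMeasure.Build _ _ _ (uniform_on A)
  uniform_on0 uniform_on_ge0 uniform_on_sigma_additive.

Let uniform_on_fin : fin_num_fun (uniform_on A).
Proof.
move=> X mX; rewrite /uniform_on fin_numM// sum_fin_num.
by apply/allP => _ /mapP[a _ ->]; rewrite diracE.
Qed.

HB.instance Definition _ := @Measure_isFinite.Build _ _ _ (uniform_on A)
  uniform_on_fin.

End uniform_on_measure.

Definition convolution (m1 m2 : set RM -> \bar R) : set RM -> \bar R :=
  pushforward (m1 \x m2) (fun p : RM * RM => (p.1 + p.2)%R : RM).

Section convolution_measure.
Variables m1 m2 : {finite_measure set RM -> \bar R}.

Let measurable_add :
  measurable_fun [set: RM * RM] (fun p : RM * RM => (p.1 + p.2)%R : RM).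
Proof. by apply: measurable_realfun.measurable_funD; [exact: measurable_fst|exact: measurable_snd]. Qed.

Let add_mfun := mfun_Sub (mem_set measurable_add).

Let convolution0 : convolution m1 m2 set0 = 0.
Proof. exact: (measure0 (pushforward (m1 \x m2) add_mfun)). Qed.

Let convolution_ge0 X : 0 <= convolution m1 m2 X.
Proof. exact: (measure_ge0 (pushforward (m1 \x m2) add_mfun)). Qed.

Let convolution_sigma_additive : semi_sigma_additive (convolution m1 m2).
Proof.
exact: (@measure_semi_sigma_additive _ _ _ (pushforward (m1 \x m2) add_mfun)).
Qed.

HB.instance Definition _ := isMeasure.Build _ _ _ (convolution m1 m2)
  convolution0 convolution_ge0 convolution_sigma_additive.

Let convolution_fin : fin_num_fun (convolution m1 m2).
Proof.
apply: lty_fin_num_fun.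
rewrite [ltLHS](_ : _ = (m1 \x m2) ([set: RM] `*` [set: RM])); last first.
  by rewrite setXTT.
by rewrite product_measure1E// lte_mul_pinfty// ?ltey_eq ?fin_num_measure.
Qed.

HB.instance Definition _ := @Measure_isFinite.Build _ _ _ (convolution m1 m2)
  convolution_fin.

End convolution_measure.

Definition scaled (c : R) (B : {fset int}) : {fset R} :=
  [fset (c^-1 * b%:~R)%R | b in B]%fset.

(* The convolution, for j = k+1, ..., k+n, of the uniform probabilities on
   (N_{k+1} ... N_j)^{-1} B_j.  Sequences are indexed from 1: N 0 and B 0
   are never used. *)
Fixpoint tail_convolution (N : nat -> nat) (B : nat -> {fset int}) (k n : nat)
    : {finite_measure set RM -> \bar R} :=
  if n is n'.+1 then
    convolution (tail_convolution N B k n')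
      (uniform_on (scaled (\prod_(k.+1 <= i < (k + n).+1) (N i)%:R)%R (B (k + n)%N)))
  else \d_(0%R : RM).

Definition weak_cvg (m : nat -> {finite_measure set RM -> \bar R})
    (mu : probability RM R) : Prop :=
  forall f : R -> R, continuous f -> (exists C : R, forall x, (`|f x| <= C)%R) ->
    ((\int[m n]_x f x)%R @[n --> \oo] --> (\int[mu]_x f x)%R).

Definition is_tail_measure (N : nat -> nat) (B : nat -> {fset int}) (k : nat)
    (nu : probability RM R) : Prop :=
  weak_cvg (tail_convolution N B k) nu.

Definition is_infinite_convolution (N : nat -> nat) (B : nat -> {fset int})
    (mu : probability RM R) : Prop :=
  is_tail_measure N B 0 mu.

Definition tight (Phi : set (probability RM R)) : Prop :=
  forall eps : R, (0 < eps)%R ->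
    exists2 K : set R, compact K &
      (1 - eps)%:E < ereal_inf [set eta K | eta in Phi].

End measures.

Section spectral.
Context {R : realType}.
Local Notation RM := (measurableTypeR R).
Local Open Scope complex_scope.
Variable mu : probability RM R.

Definition complex_integral (f : R -> R[i]) : R[i] :=
  (\int[mu]_x complex.Re (f x)) +i* (\int[mu]_x complex.Im (f x)).

Definition sq_norm (f : R -> R[i]) : \bar R :=
  (\int[mu]_x (Normc.normc (f x) ^+ 2)%:E)%E.

Definition in_L2 (f : R -> R[i]) : Prop :=
  [/\ measurable_fun [set: RM] (fun x : RM => complex.Re (f x)),
      measurable_fun [set: RM] (fun x : RM => complex.Im (f x)) &
      (sq_norm f < +oo)%E].

Definition inner (f g : R -> R[i]) : R[i] :=
  complex_integral (fun x => f x * (g x)^*).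

(* An orthonormal family of L^2(mu) indexed by D whose linear span is dense. *)
Definition orthonormal_basis (I : choiceType) (D : set I)
    (e : I -> R -> R[i]) : Prop :=
  [/\ forall i, D i -> in_L2 (e i),
      forall i j, D i -> D j -> inner (e i) (e j) = (i == j)%:R &
      forall f, in_L2 f -> forall eps : R, 0 < eps ->
        exists (s : seq I) (c : I -> R[i]), (forall i, i \in s -> D i) /\
          (sq_norm (fun x => f x - \sum_(i <- s) c i * e i x)%R < eps%:E)%E].

Definition expo (lambda x : R) : R[i] :=
  cos (2 * pi * lambda * x) -i* sin (2 * pi * lambda * x).

Definition spectral_measure : Prop :=
  exists Lambda : set R, countable Lambda /\ orthonormal_basis Lambda expo.

End spectral.

(* Main.v *)
Require Import Defs.
From mathcomp Require Import all_boot all_order all_algebra.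
From mathcomp Require Import finmap fraction complex.
From mathcomp Require Import all_classical all_reals all_analysis.
From mathcomp Require Import measurable_realfun ring lra.

(** Put P_k = N_1 ... N_k, let phi_k(x) be the Fourier transform of the tail
    measure nu_{>k} at x / P_k (so that phi_0 is the transform of mu), and let
    m_k(x) be the normalized exponential sum of B_k at x / P_k.  Peeling off the
    first factor of the convolution gives phi_{k-1} = m_k phi_k
    ([fourier_refinement]).  Since B_k is a complete residue system, m_k has
    period P_k, and the M_k values of |m_k|^2 along a translate of
    h_k Z / P_k Z, where h_k = P_k / M_k, add up to 1 ([crs_sum_sqr]).  The
    character polynomial vanishes on the unit circle only at M_k-th roots of
    unity, so all zeros of m_k lie in h_k Z ([mask_poly_zero]).

    Call L a spectrum of phi when phi vanishes on the nonzero differences of L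
    and the sum over L of |phi(xi - x)|^2 is 1 for generic xi; a spectrum of the
    measure mu is one of phi_0 ([spectral_spectrum]).

    Descent.  Let L be a spectrum of phi_{k-1}.  Keep, in every coset of h_k Z,
    the points of L in a single class modulo P_k, chosen arbitrarily coset by
    coset.  The points kept are orthogonal for phi_k: m_k does not vanish at
    their differences.  Hence the sum of |phi_k(xi - x)|^2 over them is at most
    1 by Bessel.  On the other hand the sum of |phi_{k-1}(xi - x)|^2 over L,
    which is 1, is the average of these sums over all the choices, with
    positive weights |m_k|^2.  So every choice gives the sum 1, that is, a
    spectrum of phi_k ([selection_complete], [spectrum_selection]).  In
    particular L meets x + h_k + P_k Z for every x in L
    ([spectrum_successor]): otherwise x could be added to a selection which is
    already complete.

    Divisibility ([spectrum_two_steps]).  Suppose that M_{k+1} does not divide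
    N_{k+1}, i.e. h_{k+1} is not in P_k Z, and let x be in a spectrum L of
    phi_{k-1}.  A selection through x is a spectrum of phi_k, so it contains a
    point y of x + h_{k+1} + P_{k+1} Z.  This y is not congruent to x modulo P_k,
    hence it lies in another coset of h_k Z, where the choice of the class was
    free.  Changing that choice, without changing it at x, produces a second
    selection, which must again contain a point of x + h_{k+1} + P_{k+1} Z; that
    point is congruent to y modulo P_k, which contradicts the new choice. *)

Set Implicit Arguments.
Unset Strict Implicit.
Unset Printing Implicit Defensive.

Import Order.TTheory GRing.Theory Num.Theory.
Import numFieldNormedType.Exports.

Local Open Scope classical_set_scope.
Local Open Scope ring_scope.

(** * Selections of digits and convexity *)

Section selections.
Variables (R : realFieldType) (X T : eqType) (m : nat).
Variables (tau : X -> T) (kap : X -> 'I_m.+1) (a : X -> R).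
Hypothesis a_ge0 : forall x, 0 <= a x.

Lemma sum_fibers (s : seq X) (P : pred X) (F : X -> R) :
  \sum_(x <- s | P x) F x =
  \sum_(t <- undup (map tau s)) \sum_(x <- s | P x && (tau x == t)) F x.
Proof.
rewrite (exchange_big_dep P) /=; last by move=> t x _ /andP[].
rewrite [LHS]big_seq_cond [RHS]big_seq_cond; apply: eq_bigr => x /andP[xs Px].
rewrite big_mkcond (bigD1_seq (tau x)) ?undup_uniq ?mem_undup ?map_f//=.
rewrite Px eqxx big1 ?addr0// => t; rewrite eq_sym => /negbTE->.
by rewrite andbF.
Qed.

(** A weighting of the digits is an average of selections; the selection taking
    in each fiber the digit that carries the most mass does at least as well. *)
Lemma sum_weighted_le (w : T -> 'I_m.+1 -> R) (s : seq X) (b : R) :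
  (forall t j, 0 <= w t j) -> (forall t, \sum_j w t j = 1) ->
  (forall c : T -> 'I_m.+1, \sum_(x <- s | kap x == c (tau x)) a x <= b) ->
  \sum_(x <- s) w (tau x) (kap x) * a x <= b.
Proof.
move=> w_ge0 w1 bessel.
pose A t j := \sum_(x <- s | (tau x == t) && (kap x == j)) a x.
pose c t := [arg max_(j > ord0) A t j]%O.
have Ac t j : A t j <= A t (c t).
  by rewrite /c; case: arg_maxP => //= i _ /(_ j isT).
apply: le_trans (bessel c); rewrite [leRHS](sum_fibers s) [leLHS](sum_fibers s).
apply: ler_sum => t _.
have -> : \sum_(x <- s | (kap x == c (tau x)) && (tau x == t)) a x = A t (c t).
  by apply: eq_bigl => x; have [->|_] := eqVneq (tau x) t; rewrite ?andbT ?andbF.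
rewrite (partition_big kap xpredT)//=.
apply: (@le_trans _ _ (\sum_j w t j * A t (c t))); last first.
  by rewrite -mulr_suml w1 mul1r.
apply: ler_sum => j _; apply: le_trans (ler_wpM2l (w_ge0 t j) (Ac t j)).
rewrite mulr_sumr le_eqVlt; apply/orP; left; apply/eqP.
by apply: eq_bigr => x /andP[/eqP-> /eqP->].
Qed.

Lemma positive_lower_bound (l : seq R) : {in l, forall x, 0 < x} ->
  exists2 e : R, 0 < e <= 1 / 2 & {in l, forall x, e <= x}.
Proof.
elim: l => [|x l IH] l_gt0; first by exists (1 / 2) => //; lra.
have [|e e0 el] := IH; first by move=> y yl; rewrite l_gt0// inE yl orbT.
have x0 : 0 < x by rewrite l_gt0// mem_head.
exists (Num.min e x); first by rewrite lt_min ge_min x0; lra.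
move=> y; rewrite inE => /predU1P[->|/el]; rewrite ge_min ?lexx ?orbT//.
by move=> ->.
Qed.

(** The total mass is affine in the weighting, is bounded by 1, and reaches 1 at
    a weighting with positive coordinates; an affine function that is maximal at
    an interior point is constant, so every selection has total mass 1.  As the
    fibers may be infinitely many, the weighting is moved only on the finitely
    many fibers that carry all the mass up to e / 2. *)
Lemma selection_complete (Lam : X -> Prop) (w : T -> 'I_m.+1 -> R) :
  (forall t j, 0 <= w t j) -> (forall t, \sum_j w t j = 1) ->
  (forall x j, Lam x -> 0 < w (tau x) j) ->
  (forall (c : T -> 'I_m.+1) s, uniq s ->
     {in s, forall x, Lam x /\ kap x = c (tau x)} -> \sum_(x <- s) a x <= 1) ->
  (forall e, 0 < e -> exists s, [/\ uniq s, {in s, forall x, Lam x} &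
     1 - e < \sum_(x <- s) w (tau x) (kap x) * a x]) ->
  forall (c : T -> 'I_m.+1) e, 0 < e -> exists s,
    [/\ uniq s, {in s, forall x, Lam x /\ kap x = c (tau x)} &
     1 - e < \sum_(x <- s) a x].
Proof.
move=> w_ge0 w1 w_gt0 bessel compl c e e0.
have e20 : 0 < e / 2 by lra.
have [s0 [us0 s0L s0e]] := compl _ e20.
pose F := map tau s0.
have [th /andP[th0 th1] thF] : exists2 th : R, 0 < th <= 1 / 2 &
    {in F, forall t, forall j, th <= w t j}.
  have [|th th0 thl] :=
      @positive_lower_bound [seq w t j | t <- F, j <- enum 'I_m.+1].
    move=> _ /allpairsP[[_ j] [/= /mapP[x xs0 ->] _ ->]].
    by apply: w_gt0; apply: s0L.
  exists th => // t tF j; apply: thl; apply/allpairsP.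
  by exists (t, j); split; rewrite //= mem_enum.
have the0 : 0 < th * (e / 2) by rewrite mulr_gt0.
have [s1 [us1 s1L s1e]] := compl _ the0.
pose s := undup (s0 ++ s1).
have us : uniq s by exact: undup_uniq.
have sL : {in s, forall x, Lam x}.
  by move=> x; rewrite mem_undup mem_cat => /orP[/s0L|/s1L].
pose W (v : T -> 'I_m.+1 -> R) := \sum_(x <- s) v (tau x) (kap x) * a x.
have W_le1 v : (forall t j, 0 <= v t j) -> (forall t, \sum_j v t j = 1) ->
    W v <= 1.
  move=> v0 v1; apply: sum_weighted_le => // d.
  rewrite -big_filter; apply: (bessel d); first exact: filter_uniq.
  by move=> x; rewrite mem_filter => /andP[/eqP xd /sL].
have sub_le (s' : seq X) (P : pred X) : uniq s' -> {subset s' <= s} ->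
    {in s', forall x, P x} ->
    \sum_(x <- s') w (tau x) (kap x) * a x <=
    \sum_(x <- s | P x) w (tau x) (kap x) * a x.
  move=> us' s's s'P.
  rewrite -[leRHS]big_filter.
  rewrite [leRHS](perm_big (s' ++ [seq x <- s | P x & x \notin s']))/=.
    by rewrite big_cat/= lerDl sumr_ge0// => x _; rewrite mulr_ge0.
  apply: uniq_perm; first exact: filter_uniq.
    rewrite cat_uniq us' filter_uniq// andbT; apply/hasPn => x.
    by rewrite mem_filter => /andP[/andP[]].
  move=> x; rewrite mem_cat !mem_filter; have [xs'|//] := boolP (x \in s').
    by rewrite s'P// s's.
  by rewrite andbT.
(* On the fibers in F, w = (1 - th) v + th 1_c: v is w pushed away from the
   selection c, and the lower bound th of w keeps it nonnegative. *)
pose v t j := if t \in F then (w t j - th * (j == c t)%:R) / (1 - th) else w t j.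
have th1' : 0 < 1 - th by lra.
have v0 t j : 0 <= v t j.
  rewrite /v; case: ifP => // tF; rewrite divr_ge0 ?(ltW th1')// subr_ge0.
  have := thF t tF j; case: (j == c t) => /=; rewrite ?mulr1 ?mulr0//.
have v1 t : \sum_j v t j = 1.
  rewrite /v; case: (t \in F) => //; rewrite -mulr_suml sumrB w1 -mulr_sumr.
  rewrite (bigD1 (c t))//= eqxx big1 ?addr0 ?mulr1 ?divff//; first lra.
  by move=> j /negbTE->.
have := W_le1 _ v0 v1; have := W_le1 _ w_ge0 w1.
rewrite /W; set WF := \sum_(x <- s | tau x \in F) w (tau x) (kap x) * a x.
set x := \sum_(x <- s | tau x \notin F) w (tau x) (kap x) * a x.
pose G := \sum_(x <- s | (tau x \in F) && (kap x == c (tau x))) a x.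
have WE : \sum_(x <- s) w (tau x) (kap x) * a x = WF + x.
  by rewrite (bigID (fun x => tau x \in F)).
rewrite WE => Wle1.
rewrite (bigID (fun x => tau x \in F))/=.
have -> : \sum_(x <- s | tau x \in F) v (tau x) (kap x) * a x =
    (WF - th * G) / (1 - th).
  rewrite mulrBl /WF /G big_mkcondr/= mulr_sumr !mulr_suml -sumrB.
  apply: eq_bigr => y yF; rewrite /v yF; case: (kap y == _) => /=; ring.
have -> : \sum_(x <- s | tau x \notin F) v (tau x) (kap x) * a x = x.
  by apply: eq_bigr => y yF; rewrite /v (negbTE yF).
rewrite -lerBrDr ler_pdivrMr// => Vle1.
have WF_gt : 1 - e / 2 < WF.
  apply: lt_le_trans s0e _; apply: sub_le => // y ys0.
    by rewrite mem_undup mem_cat ys0.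
  by rewrite map_f.
have Wx_gt : 1 - th * (e / 2) < WF + x.
  apply: lt_le_trans s1e _; rewrite -WE; apply: sub_le => // y ys1.
  by rewrite mem_undup mem_cat ys1 orbT.
exists [seq y <- s | (tau y \in F) && (kap y == c (tau y))]; split.
- exact: filter_uniq.
- by move=> y; rewrite mem_filter => /andP[/andP[_ /eqP yc] /sL].
- rewrite big_filter -/G.
  have : th * (1 - x - e / 2) < th * G by nra.
  rewrite ltr_pM2l//; lra.
Qed.

End selections.

(** * Coordinates along two nested lattices *)

Section lattice_coordinates.
Variables (R : realType) (h : R) (m : nat).
Hypothesis h_gt0 : 0 < h.

(** The coordinates of x along the tower of the lattices h Z and h (m + 1) Z: the
    offset represents the coset of x modulo h Z, and the digit represents the
    class of x modulo h (m + 1) Z inside that coset. *)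
Definition offset (x : R) : R := x - h * (Num.floor (x / h))%:~R.

Definition digit (x : R) : 'I_m.+1 :=
  inord `|(Num.floor (x / h) %% (Posz m.+1))%Z|%N.

Let h_neq0 : h != 0. Proof. by rewrite gt_eqF. Qed.

Lemma floor_shift (x : R) (z : int) :
  Num.floor ((x + h * z%:~R) / h) = Num.floor (x / h) + z.
Proof.
rewrite mulrDl [h * _]mulrC mulfK// floorDrz ?intr_int//.
by rewrite intrKfloor.
Qed.

Lemma digitE (x : R) : (digit x : nat)%:Z = (Num.floor (x / h) %% (Posz m.+1))%Z.
Proof.
have m0 : (Posz m.+1) != 0 by [].
rewrite /digit inordK; first by rewrite gez0_abs// modz_ge0.
by rewrite -ltz_nat gez0_abs ?modz_ge0// ltz_pmod.
Qed.

Lemma offset_shift (x : R) (z : int) : offset (x + h * z%:~R) = offset x.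
Proof. by rewrite /offset floor_shift intrD; ring. Qed.

Lemma eq_offset (x y : R) : offset x = offset y ->
  exists z : int, x = y + h * z%:~R.
Proof.
rewrite /offset => xy; exists (Num.floor (x / h) - Num.floor (y / h)).
rewrite intrB; lra.
Qed.

Lemma digit_shift (x : R) (z : int) :
  digit (x + h * z%:~R) = digit x <-> (Posz m.+1 %| z)%Z.
Proof.
have -> : (Posz m.+1 %| z)%Z =
    ((digit (x + h * z%:~R) : nat)%:Z == (digit x : nat)%:Z).
  by rewrite !digitE floor_shift eqz_mod_dvd addrC addKr.
by split=> [->|/eqP[] /val_inj].
Qed.

Lemma offset_digit (x : R) : exists z : int,
  x = offset x + h * (digit x)%:R + h * m.+1%:R * z%:~R.
Proof.
exists (Num.floor (x / h) %/ m.+1)%Z.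
have := congr1 (intr : int -> R) (divz_eq (Num.floor (x / h)) m.+1).
rewrite intrD intrM -digitE /offset !pmulrn => ->; ring.
Qed.

End lattice_coordinates.

(** * Spectra and their descent through a mask *)

Section spectra.
Variable R : realType.
Implicit Types (g u : R -> R) (L E : set R) (h x y xi : R).

(** In what follows g stands for the squared modulus of a Fourier transform, so
    that a set is [pairwise_null] when its exponentials are orthogonal. *)
Definition pairwise_null g L :=
  forall x y, L x -> L y -> x <> y -> g (x - y) = 0.

Definition bessel g := forall s : seq R, uniq s -> pairwise_null g [set` s] ->
  forall xi, \sum_(x <- s) g (xi - x) <= 1.

(** Completeness is Parseval's identity for the exponentials with frequency xi.
    A countable set of frequencies is left out because the descent from one
    level to the next weights x by the value of a mask at xi - x, and needs
    these weights to be positive. *)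
Definition spectrum g L := [/\ countable L, pairwise_null g L &
  exists2 E, countable E & forall xi, ~ E xi -> forall e, 0 < e ->
    exists s : seq R, [/\ uniq s, {in s, forall x, L x} &
      1 - e < \sum_(x <- s) g (xi - x)]].

(** The properties of the squared modulus of the exponential sum of a complete
    residue system modulo m + 1, in a scale where its period is h (m + 1). *)
Definition mask h m u := [/\ forall x, 0 <= u x,
  forall x (z : int), u (x + h * m.+1%:R * z%:~R) = u x,
  u 0 <> 0, forall x, u x = 0 -> exists z : int, x = h * z%:~R &
  forall x, \sum_(j < m.+1) u (x - h * j%:R) = 1].

Lemma countable_sub L L' : L `<=` L' -> countable L' -> countable L.
Proof. by move=> /subset_card_le /sub_countable; apply. Qed.

(** A countable set is Lebesgue null, so it contains no interval. *)
Lemma countable_dense E x e : countable E -> 0 < e ->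
  exists2 y, `|y - x| < e & ~ E y.
Proof.
move=> cE e0; apply/not_exists2P => /= nE.
have sE : `]x - e, x + e[%classic `<=` E.
  move=> y /=; rewrite in_itv/= => /andP[y1 y2]; have [|/contrapT//] := nE y.
  by rewrite ltr_norml; case/negP; lra.
have := countable_lebesgue_measure0 (countable_sub sE cE).
rewrite lebesgue_measure_itv/= lte_fin ifT; last by lra.
by rewrite -EFinB => -[]; lra.
Qed.

Section step.
Variables (h : R) (m : nat) (u g0 g1 : R -> R).
Hypotheses (h_gt0 : 0 < h) (u_mask : mask h m u).
Hypotheses (g1_ge0 : forall x, 0 <= g1 x) (g1_bessel : bessel g1).
Hypothesis g01 : forall x, g0 x = u x * g1 x.

Local Notation tau := (offset h).
Local Notation kap := (digit h m).

(** A zero of u is in h Z; by periodicity it is not in h (m + 1) Z, since u does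
    not vanish at 0. *)
Lemma mask_neq0 x y : (tau x = tau y -> kap x = kap y) -> u (x - y) <> 0.
Proof.
have [_ uP u0 uZ _] := u_mask; move=> xy uxy.
have [z xyz] := uZ _ uxy; have xE : x = y + h * z%:~R by rewrite -xyz; ring.
have : kap x = kap y by apply: xy; rewrite xE offset_shift.
rewrite {1}xE => /digit_shift => /(_ h_gt0) /dvdzP[q zq].
apply: u0; rewrite -[RHS]uxy xyz zq intrM -(uP 0 q); congr u.
by rewrite add0r -[m.+1%:R]/(m.+1%:Z%:~R); ring.
Qed.

Lemma null_step x y : (tau x = tau y -> kap x = kap y) -> g0 (x - y) = 0 ->
  g1 (x - y) = 0.
Proof.
move=> /mask_neq0 /eqP uxy /eqP; rewrite g01 mulf_eq0 (negbTE uxy) /=.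
by move/eqP.
Qed.

(** All the selections are orthogonal for g1, and the mass of L for g0 is an
    average of their masses for g1 with weights given by u; the weights are
    positive as soon as xi is off the lattice cosets of L. *)
Lemma spectrum_selection L (c : R -> 'I_m.+1) : spectrum g0 L ->
  spectrum g1 [set x | L x /\ kap x = c (tau x)].
Proof.
have [u_ge0 uP u0 uZ u1] := u_mask.
move=> [cL nL [E cE compl]]; set L' := [set x | _ /\ _].
have sL' : L' `<=` L by move=> x [].
have nL' : pairwise_null g1 L'.
  move=> x y [Lx xc] [Ly yc] xy; apply: null_step; last exact: nL.
  by rewrite xc yc => ->.
split=> //; first exact: countable_sub cL.
exists (\bigcup_(z : option int)
    if z is Some z then [set x + h * z%:~R | x in L] else E).
  apply: bigcup_countable => [|[z|] _ //]; first exact: countableP.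
  exact: sub_countable (card_image_le _ _) cL.
move=> xi xiE.
have xi_E : ~ E xi by move=> Exi; apply: xiE; exists None.
have xiL x z : L x -> xi - x <> h * z%:~R.
  move=> Lx xz; apply: xiE; exists (Some z) => //; exists x => //.
  by rewrite -xz; ring.
pose w t (j : 'I_m.+1) := u (xi - t - h * j%:R).
have wE x : w (tau x) (kap x) = u (xi - x).
  have [z xE] := offset_digit h m x.
  rewrite /w -[RHS](uP _ z); congr u; rewrite [in RHS]xE; ring.
apply: (@selection_complete _ _ _ _ tau kap _ _ L w).
- by move=> x; exact: g1_ge0.
- by move=> t j; exact: u_ge0.
- by move=> t; exact: u1.
- move=> x j Lx; rewrite lt_def u_ge0 andbT; apply/eqP => /uZ[z wz].
  apply: (xiL x (z + j%:Z - Num.floor (x / h))) => //.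
  rewrite intrB intrD mulrBr mulrDr -wz /offset -pmulrn; ring.
- move=> d s us sL; apply: g1_bessel => // x y /= /sL [Lx xd] /sL [Ly yd] xy.
  by apply: null_step; [rewrite xd yd => ->|exact: nL].
- move=> e /(compl xi xi_E)[s [us sL se]]; exists s; split => //.
  by under eq_bigr do rewrite wE -g01.
Qed.

(** If L misses the class of x + h, then the selection of the digit of x + h
    everywhere has no point in the coset of x.  Adding x to it keeps it
    orthogonal for g1, but it is already complete: for xi close to x, the
    additional term g1 (xi - x) breaks Bessel's inequality. *)
Lemma spectrum_successor L x : spectrum g0 L -> L x ->
  (exists2 d, 0 < d & forall y, `|y| < d -> 0 < g1 y) ->
  exists2 y, L y & exists z : int, y = x + h + h * m.+1%:R * z%:~R.
Proof.
move=> sL Lx [d d0 g1d]; apply/not_exists2P => noy.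
have [cL nL _] := sL.
have [cL' nL' [E cE compl]] := spectrum_selection (fun=> kap (x + h)) sL.
set L' := [set _ | _ /\ _] in cL' nL' compl.
have L'x y : L' y -> tau y <> tau x.
  move=> [Ly yx] txy; have [//|] := noy y; apply.
  have txh : tau y = tau (x + h).
    by rewrite txy -(offset_shift h_gt0 x 1) mulr1.
  have [z yE] := eq_offset txh.
  move: yx; rewrite yE => /digit_shift => /(_ h_gt0) /dvdzP[q ->].
  by exists q; rewrite intrM -[m.+1%:R]/(m.+1%:Z%:~R); ring.
have [xi xix Exi] := countable_dense x cE d0.
have g1x : 0 < g1 (xi - x) by exact: g1d.
have [s [us ss sg]] := compl xi Exi _ g1x.
have : \sum_(y <- x :: s) g1 (xi - y) <= 1.
  apply: g1_bessel.
    by rewrite /= us andbT; apply/negP => /ss /L'x.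
  have nx y : y \in s -> tau y <> tau x by move=> /ss /L'x.
  move=> y z /=; rewrite !inE => /predU1P[->|ys] /predU1P[->|zs] yz //.
  - apply: null_step; first by move=> /esym /(nx _ zs).
    by apply: nL => //; have [] := ss _ zs.
  - apply: null_step; first by move=> /(nx _ ys).
    by apply: nL => //; have [] := ss _ ys.
  - by apply: nL' => //; apply: ss.
rewrite big_cons; lra.
Qed.

End step.
End spectra.

(** * Two consecutive levels *)

Section two_steps.
Variables (R : realType) (h h' : R) (m m' : nat) (u u' g0 g1 g2 : R -> R).
Hypotheses (h_gt0 : 0 < h) (h'_gt0 : 0 < h') (m_gt0 : (0 < m)%N).
Hypotheses (u_mask : mask h m u) (u'_mask : mask h' m' u').
Hypotheses (g1_ge0 : forall x, 0 <= g1 x) (g1_bessel : bessel g1).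
Hypotheses (g2_ge0 : forall x, 0 <= g2 x) (g2_bessel : bessel g2).
Hypothesis g2_gt0 : exists2 d, 0 < d & forall y, `|y| < d -> 0 < g2 y.
Hypotheses (g01 : forall x, g0 x = u x * g1 x)
  (g12 : forall x, g1 x = u' x * g2 x).

Lemma spectrum_nonempty g (L : set R) : spectrum g L -> exists x, L x.
Proof.
move=> [_ _ [E cE compl]].
have [xi _ /compl/(_ 1 ltr01)[s [_ sL]]] := countable_dense 0 cE (@ltr01 R).
case: s sL => [|x s] sL; first by rewrite big_nil subrr ltxx.
by move=> _; exists x; apply: sL; rewrite mem_head.
Qed.

(** If h' is off the lattice h (m + 1) Z, the successor y of x at the second
    level lies in another coset of h Z than x, so a selection through x may have
    any digit there; but its successor of x always has the digit of y. *)
Lemma spectrum_two_steps (n : nat) (L : set R) : spectrum g0 L ->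
  h' * m'.+1%:R = h * m.+1%:R * n%:R ->
  exists z : int, h' = h * m.+1%:R * z%:~R.
Proof.
move=> sL hh'; have [x Lx] := spectrum_nonempty sL.
apply: contrapT => h'P.
pose same y := offset h y = offset h x.
have digitP y (z : int) : digit h m (y + h * m.+1%:R * z%:~R) = digit h m y.
  rewrite -mulrA -[m.+1%:R]/(m.+1%:Z%:~R) -intrM.
  by apply/digit_shift => //; rewrite dvdz_mulr.
have offsetP y (z : int) : offset h (y + h * m.+1%:R * z%:~R) = offset h y.
  by rewrite -mulrA -[m.+1%:R]/(m.+1%:Z%:~R) -intrM offset_shift.
(* The successor of x in the selection c, at the second level; by hh' its
   period h' (m' + 1) is in h (m + 1) Z. *)
have next (c : R -> 'I_m.+1) : digit h m x = c (offset h x) ->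
    exists2 y, digit h m y = c (offset h y) &
      exists z : int, y = x + h' + h * m.+1%:R * z%:~R.
  move=> xc.
  have [||y [_ yc] [z yE]] := spectrum_successor h'_gt0 u'_mask g2_ge0 g2_bessel
    g12 (spectrum_selection h_gt0 u_mask g1_ge0 g1_bessel g01 c sL) (x := x).
  - by split.
  - exact: g2_gt0.
  - exists y => //; exists (n%:Z * z).
    by rewrite yE hh' intrM -pmulrn; ring.
have [y yd [z yE]] := next (fun=> digit h m x) erefl.
have ny : offset h y <> offset h x.
  move=> /eq_offset[w ywE]; have := yd; rewrite ywE => /digit_shift.
  move=> /(_ h_gt0) /dvdzP[q wE]; apply: h'P; exists (q - z).
  move: ywE; rewrite yE wE intrM intrB -[m.+1%:R]/(m.+1%:Z%:~R); lra.
pose other : 'I_m.+1 := if digit h m x == ord0 then ord_max else ord0.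
have other_neq : other <> digit h m x.
  rewrite /other; case: eqP => [->|+ /esym//].
  by move=> /(congr1 val) /= m0; have := m_gt0; rewrite m0.
have [|y' yd' [z' yE']] :=
  next (fun t => if t == offset h x then digit h m x else other).
  by rewrite eqxx.
have y'E : y' = y + h * m.+1%:R * (z' - z)%:~R.
  by rewrite yE' yE intrB; ring.
move: yd'; rewrite y'E digitP offsetP yd; case: eqP => // _ /esym.
exact: other_neq.
Qed.

End two_steps.

Lemma spectrum_chain (R : realType) (h : nat -> R) (m : nat -> nat)
    (u g : nat -> R -> R) (L : set R) :
  (forall k, 0 < h k) -> (forall k, mask (h k) (m k) (u k)) ->
  (forall k x, 0 <= g k x) -> (forall k, bessel (g k)) ->
  (forall k x, g k x = u k x * g k.+1 x) ->
  spectrum (g 0%N) L -> forall k, exists L', spectrum (g k) L'.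
Proof.
move=> h_gt0 u_mask g_ge0 g_bessel gS sL; elim=> [|k [L' sL']]; first by exists L.
eexists; exact: (spectrum_selection (h_gt0 k) (u_mask k) (g_ge0 k.+1)
  (g_bessel k.+1) (gS k) (fun=> ord0) sL').
Qed.

(** * Evaluation of the character polynomial *)

Section character_polynomial_evaluation.

Lemma expz_shift (F : fieldType) (y : F) (e : int) (N : nat) :
  y != 0 -> (`|e| <= N)%N -> y ^ e * y ^+ N = y ^+ absz (e + N%:Z).
Proof.
move=> y0 eN; rewrite [y ^+ N]exprnP -expfzDr// [RHS]exprnP gez0_abs//.
have eN' : `|e| <= N%:Z by rewrite -abszE lez_nat.
by rewrite -lerBlDr sub0r lerNl (le_trans (ler_norm _))// normrN.
Qed.

(** Multiplying by the N-th power of the variable makes all exponents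
    nonnegative, so an identity between rational functions becomes one between
    polynomials and can be evaluated anywhere. *)
Lemma clear_denominators (F : fieldType) (f : {rmorphism {poly int} -> F})
    (s : seq int) (e : int) (M N : nat) (S : {poly int}) :
  injective f -> (0 < M)%N -> (`|e| <= N)%N -> {in s, forall b, (`|b| <= N)%N} ->
  (\sum_(b <- s) f 'X ^ b) / (f 'X ^ e * \sum_(k < M) f 'X ^+ k) = f S ->
  \sum_(b <- s) 'X^(absz (b + N%:Z)) =
  'X^(absz (e + N%:Z)) * (\sum_(k < M) 'X^k) * S.
Proof.
move=> f_inj M0 eN sN; set x := f 'X; set D : {poly int} := \sum_(k < M) 'X^k.
have f_eq0 p : (f p == 0) = (p == 0) by rewrite -(rmorph0 f) (inj_eq f_inj).
have x0 : x != 0 by rewrite f_eq0 polyX_eq0.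
have DE : \sum_(k < M) x ^+ k = f D.
  by rewrite rmorph_sum; apply: eq_bigr => k _; rewrite rmorphXn.
have D0 : D != 0.
  apply: contraTneq M0 => /(congr1 (fun p : {poly int} => p.[1])).
  rewrite horner_sum horner0 (eq_bigr (fun=> 1)); last first.
    by move=> k _; rewrite hornerXn expr1n.
  by rewrite sumr_const card_ord => /eqP; rewrite pnatr_eq0 => /eqP->.
have den0 : x ^ e * f D != 0 by rewrite mulf_neq0 ?expfz_neq0// f_eq0.
rewrite DE => /(canRL (divfK den0)) E; apply: f_inj.
rewrite !rmorphM rmorphXn -/x -expz_shift// rmorph_sum.
rewrite (eq_big_seq (fun b => x ^ b * x ^+ N)); last first.
  by move=> b /sN bN; rewrite rmorphXn expz_shift.
rewrite -mulr_suml E; ring.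
Qed.

Lemma character_polynomial_eval (C : fieldType) (B : {fset int})
    (S : {poly int}) (z : C) : (0 < #|` B|)%N -> z != 0 ->
  character_polynomial B = tofrac S ->
  \sum_(b <- B) z ^ b =
  z ^ fset_min B * (\sum_(k < #|` B|) z ^+ k) * (map_poly intr S).[z].
Proof.
move=> B0 z0 Bf; pose N := (`|fset_min B| + \sum_(b <- B) `|b|)%N.
have NB b : b \in B -> (`|b| <= N)%N.
  by move=> bB; rewrite /N (big_rem b)//= addnCA leq_addr.
have Nmin : (`|fset_min B| <= N)%N by exact: leq_addr.
have tofrac_inj : injective (@tofrac {poly int}).
  by move=> p q /eqP; rewrite tofrac_eq => /eqP.
have := clear_denominators tofrac_inj B0 Nmin NB Bf.
move=> /(congr1 (fun p => (map_poly intr p).[z])).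
rewrite rmorph_sum horner_sum.
rewrite (eq_big_seq (fun b => z ^ b * z ^+ N)); last first.
  by move=> b /NB bN; rewrite /= map_polyXn hornerXn expz_shift.
rewrite -mulr_suml !rmorphM !hornerM /= map_polyXn hornerXn -expz_shift//.
have -> : (map_poly intr (\sum_(k < #|` B|) 'X^k)).[z] =
    \sum_(k < #|` B|) z ^+ k.
  rewrite rmorph_sum horner_sum; apply: eq_bigr => k _.
  by rewrite /= map_polyXn hornerXn.
move=> E; apply: (@mulIf _ (z ^+ N)); first by rewrite expf_neq0.
rewrite E; ring.
Qed.

End character_polynomial_evaluation.

(** * Exponential sums of complete residue systems *)

Section unit_characters.
Variable R : realType.
Local Notation C := R[i].
Local Notation normc := Normc.normc.
Implicit Types (x y : R) (z w : C).

Lemma normc_sqrE z : (normc z ^+ 2)%:C%C = z * (z^*)%C.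
Proof.
case: z => a b /=; rewrite sqr_sqrtr ?addr_ge0 ?sqr_ge0//.
by apply/eqP; rewrite eq_complex /=; apply/andP; split; apply/eqP; ring.
Qed.

Lemma normc_sqr_eq0 z : normc z ^+ 2 = 0 -> z = 0.
Proof. by move/eqP; rewrite sqrf_eq0 => /eqP /Normc.eq0_normc. Qed.

Definition expi x : C := expo x 1.

Lemma expoE (l x : R) : expo l x = expi (l * x).
Proof. by rewrite /expi /expo mulr1 mulrA. Qed.

Lemma expiE x : expi x = (cos (2 * pi * x) -i* sin (2 * pi * x))%C.
Proof. by rewrite /expi /expo mulr1. Qed.

Lemma expi0 : expi 0 = 1.
Proof. by rewrite expiE mulr0 cos0 sin0 oppr0. Qed.

Lemma expiD x y : expi (x + y) = expi x * expi y.
Proof.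
rewrite !expiE mulrDr cosD sinD; apply/eqP; rewrite eq_complex /=.
by apply/andP; split; apply/eqP; ring.
Qed.

Lemma expiN x : expi (- x) = ((expi x)^*)%C.
Proof. by rewrite !expiE mulrN cosN sinN. Qed.

Lemma expi_neq0 x : expi x != 0.
Proof.
apply/eqP => x0; have := expiD x (- x); rewrite subrr expi0 x0 mul0r => /eqP.
by rewrite oner_eq0.
Qed.

Lemma expiV x : expi (- x) = (expi x)^-1.
Proof.
apply: (mulIf (expi_neq0 x)); rewrite mulVf ?expi_neq0//.
by rewrite -expiD addNr expi0.
Qed.

Lemma expiMn x (n : nat) : expi (n%:R * x) = expi x ^+ n.
Proof.
elim: n => [|n IH]; first by rewrite mul0r expi0.
by rewrite -natr1 mulrDl mul1r expiD IH exprSr.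
Qed.

Lemma expiMz x (n : int) : expi (n%:~R * x) = expi x ^ n.
Proof.
case: n => n; first by rewrite -[_%:~R]/(n%:R) expiMn.
by rewrite NegzE intrN mulNr expiV -[_%:~R]/(n.+1%:R) expiMn exprnN.
Qed.

Lemma expi_int (n : int) : expi n%:~R = 1.
Proof.
have e1 : expi 1 = 1.
  by rewrite expiE mulr1 mulr_natl cos2pi sin2pi oppr0.
by rewrite -[n%:~R]mulr1 expiMz e1 exp1rz.
Qed.

(** With t the fractional part of x, cos (2 pi t) = 1 forces sin (pi t) = 0, but
    the sine is positive on the open interval from 0 to pi. *)
Lemma expi_eq1 x : expi x = 1 -> exists n : int, x = n%:~R.
Proof.
move=> x1; exists (Num.floor x).
have /andP[fx xf] := floor_itv x.
pose t := x - (Num.floor x)%:~R; have t0 : 0 <= t by rewrite subr_ge0.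
have t1 : t < 1 by move: xf; rewrite intrD /t; lra.
have : expi t = 1 by rewrite expiD -intrN expi_int x1 mulr1.
rewrite expiE => -[+ _].
have -> : 2 * pi * t = (pi * t) *+ 2 by ring.
rewrite cos_mulr2n cos2sin2 => st.
have st0 : sin (pi * t) = 0.
  by apply/eqP; rewrite -sqrf_eq0; apply/eqP; lra.
have [/eqP|tn0] := boolP (t == 0); first by rewrite /t; lra.
have tgt0 : 0 < t by rewrite lt_def tn0.
have /sin_gt0_pi : 0 < pi * t < pi.
  by rewrite mulr_gt0 ?pi_gt0// gtr_pMr ?pi_gt0.
by rewrite st0 ltxx.
Qed.

Lemma normc_expi x : normc (expi x) = 1.
Proof. by rewrite expiE /= sqrrN cos2Dsin2 sqrtr1. Qed.

Lemma sum_roots_of_unity (M : nat) w : w ^+ M = 1 -> w <> 1 ->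
  \sum_(j < M) w ^+ j = 0.
Proof.
move=> wM w1; have := subrX1 w M; rewrite wM subrr => /esym/eqP.
by rewrite mulf_eq0 subr_eq0 => /orP[/eqP //|/eqP].
Qed.

Lemma root_of_unity_of_sum0 (M : nat) w : \sum_(j < M) w ^+ j = 0 -> w ^+ M = 1.
Proof.
by move=> w0; apply/eqP; rewrite -subr_eq0 subrX1 w0 mulr0.
Qed.

End unit_characters.
Arguments expi : simpl never.

Section residue_masks.
Variable R : realType.
Local Notation C := R[i].
Local Notation normc := Normc.normc.

Definition mask_poly (B : {fset int}) (x : R) : C :=
  (#|` B|%:R)^-1 * \sum_(b <- B) expi (b%:~R * x).

Lemma mask_poly_shift B (x : R) (z : int) :
  mask_poly B (x + z%:~R) = mask_poly B x.
Proof.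
rewrite /mask_poly; congr (_ * _); apply: eq_bigr => b _.
by rewrite mulrDr -intrM expiD expi_int mulr1.
Qed.

Lemma mask_poly0 B : (0 < #|` B|)%N -> mask_poly B 0 = 1.
Proof.
move=> B0; rewrite /mask_poly (eq_bigr (fun=> 1)) => [|b _]; last first.
  by rewrite mulr0 expi0.
rewrite big_const_seq count_predT iter_addr_0 mulVf//.
by rewrite pnatr_eq0 -lt0n.
Qed.

Lemma conj_mask_poly B (x : R) :
  ((mask_poly B x)^*)%C = (#|` B|%:R)^-1 * \sum_(b <- B) expi (- (b%:~R * x)).
Proof.
rewrite /mask_poly rmorphM rmorph_sum fmorphV rmorph_nat; congr (_ * _).
by apply: eq_bigr => b _; rewrite expiN.
Qed.

(** Parseval's identity on Z / M Z: expanding the squares, the sum over j of the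
    cross term of b and b' is a full sum of powers of an M-th root of unity,
    which is not 1 because distinct elements of B are not congruent. *)
Lemma crs_sum_sqr (B : {fset int}) (M : nat) (x : R) : (0 < M)%N ->
  complete_residue_system B M ->
  \sum_(j < M) normc (mask_poly B (x - j%:R / M%:R)) ^+ 2 = 1.
Proof.
move=> M0 [BM Br].
have M0' : M%:R != 0 :> R by rewrite pnatr_eq0 -lt0n.
have M0C : M%:R != 0 :> C by rewrite pnatr_eq0 -lt0n.
apply: complexI; rewrite raddf_sum /=.
under eq_bigr => j _ do rewrite /= normc_sqrE.
pose a b b' := expi ((b - b')%:~R * x) : C.
pose om b b' := expi ((b' - b)%:~R / M%:R) : C.
rewrite (eq_bigr (fun j : 'I_M => (M%:R ^+ 2)^-1 *
    \sum_(b <- B) \sum_(b' <- B) a b b' * om b b' ^+ j)); last first.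
  move=> j _; rewrite conj_mask_poly /mask_poly BM mulrACA -invfM -expr2.
  congr (_ * _); rewrite mulr_suml; apply: eq_bigr => b _; rewrite mulr_sumr.
  apply: eq_bigr => b' _; rewrite /a /om -expiMn -!expiD.
  by congr expi; rewrite !intrB; field.
rewrite -mulr_sumr exchange_big /=.
rewrite (eq_big_seq (fun=> M%:R)) => [|b bB].
  rewrite big_const_seq count_predT iter_addr_0 BM -[X in _ * X]mulr_natr.
  by rewrite -expr2 mulVf// expf_neq0.
rewrite exchange_big /= (bigD1_seq b)//= ?fset_uniq// [X in _ + X]big1_seq ?addr0.
  have -> : om b b = 1 by rewrite /om subrr mul0r expi0.
  have -> : a b b = 1 by rewrite /a subrr mul0r expi0.
  under eq_bigr do rewrite expr1n mulr1.
  by rewrite sumr_const card_ord.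
move=> b' /andP[b'b b'B]; rewrite -mulr_sumr sum_roots_of_unity ?mulr0//.
  by rewrite /om -expiMn mulrC divfK// expi_int.
move=> /expi_eq1[n nE].
have nE' : b' - b = n * M%:Z.
  by apply: (@intr_inj R); rewrite intrM -nE divfK.
have Mz : M%:Z != 0 by rewrite eqz_nat -lt0n.
have rE : (b = `|(b %% M%:Z)%Z|%N %[mod M])%Z.
  by rewrite gez0_abs ?modz_ge0// modz_mod.
have [|b0 [_ b0U]] := Br `|(b %% M%:Z)%Z|%N.
  by rewrite -ltz_nat gez0_abs ?modz_ge0// ltz_pmod// ltz_nat.
move/eqP: b'b; apply; rewrite -(b0U b)// -(b0U b')//; split=> //.
by rewrite -rE; apply/eqP; rewrite eqz_mod_dvd nE'; exact: dvdz_mull.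
Qed.

(** With z = expi x, a zero is either one of the geometric sum, whence z ^ M = 1,
    or one of the alternating sum, whence (- z) ^ (2 n + 1) = 1 and
    z ^ (4 n + 2) = 1. *)
Lemma mask_poly_zero (B : {fset int}) (M n : nat) (x : R) : (0 < M)%N ->
  #|` B| = M -> (4 * n + 2 %| M)%N ->
  character_polynomial B = tofrac (\sum_(0 <= i < (2 * n).+1) (- 'X) ^+ i) ->
  mask_poly B x = 0 -> exists z : int, M%:R * x = z%:~R.
Proof.
move=> M0 BM nM Bf; rewrite /mask_poly => /eqP; rewrite mulf_eq0 invr_eq0.
rewrite BM pnatr_eq0 -[_ == 0%N]negbK -lt0n M0 /=.
under eq_bigr do rewrite expiMz.
rewrite (character_polynomial_eval _ (expi_neq0 x) Bf) ?BM//.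
have -> : (map_poly intr (\sum_(0 <= i < (2 * n).+1) (- 'X) ^+ i)).[expi x] =
    \sum_(i < (2 * n).+1) (- expi x) ^+ i.
  rewrite rmorph_sum horner_sum big_mkord; apply: eq_bigr => i _.
  by rewrite rmorphXn rmorphN /= map_polyX horner_exp hornerN hornerX.
rewrite !mulf_eq0 (negbTE (expfz_neq0 _ (expi_neq0 x))) /=.
move=> xM; apply: expi_eq1; rewrite expiMn.
case/orP: xM => /eqP /root_of_unity_of_sum0// x1.
move/dvdnP: nM => [q ->].
have -> : (q * (4 * n + 2) = ((2 * n).+1 * 2) * q)%N by ring.
rewrite exprM [((2 * n).+1 * 2)%N]mulnC exprM -sqrrN [X in X ^+ q]exprAC x1.
by rewrite !expr1n.
Qed.

End residue_masks.

(** * Integrals against convolutions and uniform probabilities *)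

Section bounded_integrals.
Variable R : realType.
Local Notation RM := (measurableTypeR R).
Implicit Types m : {finite_measure set RM -> \bar R}.

Lemma bounded_integrable d (T : measurableType d)
    (m : {measure set T -> \bar R}) (f : T -> R) (b : R) :
  (m setT < +oo)%E -> measurable_fun [set: T] f -> (forall x, `|f x| <= b) ->
  m.-integrable [set: T] (EFin \o f).
Proof.
move=> mT mf fb; apply: measurable_bounded_integrable => //.
exists b; split; first exact: num_real.
by move=> c bc x _ /=; rewrite (le_trans (fb x))// ltW.
Qed.

Lemma continuous_bounded_integrable m (f : R -> R) (b : R) :
  continuous f -> (forall x, `|f x| <= b) -> m.-integrable setT (EFin \o f).
Proof.
move=> cf fb; apply: (@bounded_integrable _ RM m f b) => //; last first.
  exact: continuous_measurable_fun.
by rewrite -ge0_fin_numE// fin_num_measure.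
Qed.

Lemma Rintegral_convolution m1 m2 (f : R -> R) (b : R) :
  continuous f -> (forall x, `|f x| <= b) ->
  \int[convolution m1 m2]_z f z = \int[m1]_x \int[m2]_y f (x + y).
Proof.
move=> cf fb.
pose add (p : RM * RM) : RM := p.1 + p.2.
have madd : measurable_fun [set: RM * RM] add.
  by apply: measurable_funD; [exact: measurable_fst|exact: measurable_snd].
have mf : measurable_fun [set: RM] f by exact: continuous_measurable_fun.
have ifadd : (m1 \x m2)%E.-integrable setT (EFin \o (f \o add)).
  apply: (@bounded_integrable _ _ (m1 \x m2)%E _ b).
  - rewrite [ltLHS](_ : _ = (m1 \x m2)%E ([set: RM] `*` [set: RM])).
      by rewrite product_measure1E// lte_mul_pinfty// ?ltey_eq ?fin_num_measure.
    by rewrite setXTT.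
  - exact: measurableT_comp.
  - by move=> x; exact: fb.
rewrite /Rintegral; congr fine.
rewrite (@integral_pushforward _ _ _ _ _ add madd (m1 \x m2)%E setT
  (EFin \o f))//=; last first.
  exact/measurable_EFinP.
rewrite -integral12_prod_meas1//; apply: eq_integral => x _.
rewrite /fubini_F fineK//; apply: integrable_fin_num => //.
apply: (@continuous_bounded_integrable m2 (fun y => f (x + y)) b) => // y.
apply: continuous_comp; last exact: cf.
by apply: cvgD; [exact: cvg_cst|exact: cvg_id].
Qed.

Lemma uniform_onE (A : {fset R}) (X : set RM) :
  uniform_on A X = ((#|` A|%:R)^-1%:E * \sum_(a <- A) \d_(a : RM) X)%E.
Proof. by []. Qed.

Lemma ge0_integral_uniform_on (A : {fset R}) (f : R -> R) :
  continuous f -> (forall x, 0 <= f x) ->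
  (\int[uniform_on A]_x (f x)%:E)%E = ((#|` A|%:R)^-1 * \sum_(a <- A) f a)%:E.
Proof.
move=> cf f0.
have mf : measurable_fun [set: RM] (EFin \o f).
  by apply/measurable_EFinP; exact: continuous_measurable_fun.
have c0 : 0 <= (#|` A|%:R)^-1 :> R by rewrite invr_ge0.
rewrite (@eq_measure_integral _ _ _ _
  (mscale (NngNum c0) (msum (fun i => \d_(nth 0%R A i : RM)) #|` A|))); last first.
  move=> X mX _; apply: etrans (uniform_onE A X) _.
  by rewrite /mscale /= /msum (big_nth 0%R) big_mkord.
rewrite ge0_integral_mscale//; last by move=> x _; rewrite lee_fin.
rewrite ge0_integral_measure_sum//; last by move=> x _; rewrite lee_fin.
rewrite EFinM; congr (_ * _)%E.
rewrite (big_nth 0) big_mkord -sumEFin; apply: eq_bigr => i _.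
by rewrite integral_dirac// diracT mul1e.
Qed.

(** Adding the bound b reduces the claim to a nonnegative integrand. *)
Lemma Rintegral_uniform_on (A : {fset R}) (f : R -> R) (b : R) :
  continuous f -> (forall x, `|f x| <= b) ->
  \int[uniform_on A]_x f x = (#|` A|%:R)^-1 * \sum_(a <- A) f a.
Proof.
move=> cf fb.
have cfb : continuous (fun x => f x + b).
  by move=> x; apply: cvgD; [exact: cf|exact: cvg_cst].
have cb : continuous (fun _ : R => b) by move=> x; exact: cvg_cst.
have b0 : 0 <= b := le_trans (normr_ge0 _) (fb 0).
have fb0 x : 0 <= f x + b by have := fb x; rewrite ler_norml; lra.
have : \int[uniform_on A]_x (f x + b) =
    (#|` A|%:R)^-1 * \sum_(a <- A) f a + \int[uniform_on A]_(x in setT) b.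
  rewrite /Rintegral !ge0_integral_uniform_on//= -mulrDr -big_split.
  by [].
rewrite RintegralD//.
- by move/addIr.
- exact: continuous_bounded_integrable fb.
- by apply: (@continuous_bounded_integrable _ _ b) => // _; rewrite ger0_norm.
Qed.

End bounded_integrals.

(** * Fourier transforms *)

Section fourier_transform.
Variable R : realType.
Local Notation RM := (measurableTypeR R).
Local Notation C := R[i].
Local Notation normc := Normc.normc.
Local Notation Re := complex.Re.
Local Notation Im := complex.Im.
Implicit Types m : {finite_measure set RM -> \bar R}.

Definition fourier m (xi : R) : C :=
  ((\int[m]_x Re (expi (xi * x))) +i* (\int[m]_x Im (expi (xi * x))))%C.

Lemma Re_expi (y : R) : Re (expi y) = cos (2 * pi * y).
Proof. by rewrite expiE. Qed.

Lemma Im_expi (y : R) : Im (expi y) = - sin (2 * pi * y).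
Proof. by rewrite expiE. Qed.

Lemma ReD (z w : C) : Re (z + w) = Re z + Re w.
Proof. by case: z => a b; case: w. Qed.

Lemma ImD (z w : C) : Im (z + w) = Im z + Im w.
Proof. by case: z => a b; case: w. Qed.

Lemma ReN (z : C) : Re (- z) = - Re z.
Proof. by case: z. Qed.

Lemma ReM (z w : C) : Re (z * w) = Re z * Re w - Im z * Im w.
Proof. by case: z => a b; case: w => c d. Qed.

Lemma ImM (z w : C) : Im (z * w) = Re z * Im w + Im z * Re w.
Proof. by case: z => a b; case: w. Qed.

Lemma continuous_scale (t : R) : continuous (fun x : R => 2 * pi * (t * x)).
Proof.
by move=> x; apply: cvgM (cvg_cst _) _; apply: cvgM (cvg_cst _) cvg_id.
Qed.

Lemma continuous_Re_expi (t : R) : continuous (fun x => Re (expi (t * x))).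
Proof.
under eq_fun do rewrite Re_expi.
move=> x; apply: continuous_comp; first exact: continuous_scale.
exact: continuous_cos.
Qed.

Lemma continuous_Im_expi (t : R) : continuous (fun x => Im (expi (t * x))).
Proof.
under eq_fun do rewrite Im_expi.
move=> x; apply: continuousN; apply: continuous_comp.
  exact: continuous_scale.
exact: continuous_sin.
Qed.

Lemma Re_expi_le1 (y : R) : `|Re (expi y)| <= 1.
Proof. by rewrite Re_expi cos_max. Qed.

Lemma Im_expi_le1 (y : R) : `|Im (expi y)| <= 1.
Proof. by rewrite Im_expi normrN sin_max. Qed.

Lemma integrable_Re_expi m (t : R) :
  m.-integrable setT (EFin \o (fun x => Re (expi (t * x)))).
Proof.
apply: continuous_bounded_integrable; first exact: continuous_Re_expi.
by move=> x; exact: Re_expi_le1.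
Qed.

Lemma integrable_Im_expi m (t : R) :
  m.-integrable setT (EFin \o (fun x => Im (expi (t * x)))).
Proof.
apply: continuous_bounded_integrable; first exact: continuous_Im_expi.
by move=> x; exact: Im_expi_le1.
Qed.

Lemma integrable_scale m (c : R) (f : R -> R) :
  m.-integrable setT (EFin \o f) ->
  m.-integrable setT (EFin \o (fun x => c * f x)).
Proof. by move=> fi; exact: (@integrableZl _ _ _ m _ measurableT c _ fi). Qed.

Lemma integrable_add m (f g : R -> R) :
  m.-integrable setT (EFin \o f) -> m.-integrable setT (EFin \o g) ->
  m.-integrable setT (EFin \o (fun x => f x + g x)).
Proof. by move=> fi gi; exact: (integrableD measurableT fi gi). Qed.

Lemma Rintegral_lin m (a b : R) (f g : R -> R) :
  m.-integrable setT (EFin \o f) -> m.-integrable setT (EFin \o g) ->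
  \int[m]_x (a * f x + b * g x) = a * \int[m]_x f x + b * \int[m]_x g x.
Proof.
move=> fi gi; rewrite RintegralD//; try exact: integrable_scale.
by rewrite !RintegralZl.
Qed.

Lemma fourier_convolution m1 m2 (xi : R) :
  fourier (convolution m1 m2) xi = fourier m1 xi * fourier m2 xi.
Proof.
apply/eqP; rewrite eq_complex ReM ImM /=; apply/andP; split; apply/eqP.
- rewrite (@Rintegral_convolution _ m1 m2 _ 1 (@continuous_Re_expi xi)
    (fun=> Re_expi_le1 _)).
  under eq_Rintegral => x _.
    under eq_Rintegral => y _.
      rewrite mulrDr expiD ReM -mulNr; over.
    rewrite Rintegral_lin; [|exact: integrable_Re_expi|exact: integrable_Im_expi].
    rewrite mulrC [- _ * _]mulrC mulrN -mulNr; over.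
  rewrite Rintegral_lin; [|exact: integrable_Re_expi|exact: integrable_Im_expi].
  ring.
- rewrite (@Rintegral_convolution _ m1 m2 _ 1 (@continuous_Im_expi xi)
    (fun=> Im_expi_le1 _)).
  under eq_Rintegral => x _.
    under eq_Rintegral => y _.
      rewrite mulrDr expiD ImM; over.
    rewrite Rintegral_lin; [|exact: integrable_Im_expi|exact: integrable_Re_expi].
    rewrite mulrC [X in _ + X]mulrC; over.
  rewrite Rintegral_lin; [|exact: integrable_Re_expi|exact: integrable_Im_expi].
  ring.
Qed.

Lemma fourier_uniform_on (c : R) (B : {fset int}) (xi : R) : c != 0 ->
  fourier (uniform_on (scaled c B)) xi = mask_poly B (xi / c).
Proof.
move=> c0.
have inj : {in B &, injective (fun b : int => c^-1 * b%:~R : R)}.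
  by move=> a b _ _ /(mulfI (invr_neq0 c0)) /intr_inj.
rewrite /fourier (@Rintegral_uniform_on _ _ _ 1
  (@continuous_Re_expi xi) (fun=> Re_expi_le1 _)) (@Rintegral_uniform_on _ _ _ 1
  (@continuous_Im_expi xi) (fun=> Im_expi_le1 _)).
rewrite /scaled card_in_imfset// !big_imfset//= /mask_poly.
have -> : (#|` B|%:R : C)^-1 = ((#|` B|%:R)^-1)%:C%C.
  by rewrite fmorphV rmorph_nat.
have arg b : xi * (c^-1 * b%:~R) = b%:~R * (xi / c) by ring.
apply/eqP; rewrite eq_complex ReM ImM /= !mul0r subr0 addr0.
by rewrite !raddf_sum /=; apply/andP; split; apply/eqP; congr (_ * _);
  apply: eq_bigr => b _; rewrite arg.
Qed.

Lemma fourier_dirac0 (xi : R) : fourier (\d_(0%R : RM)) xi = 1.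
Proof.
rewrite /fourier /Rintegral !integral_dirac//.
- by rewrite diracT !mul1e mulr0 expi0.
- apply/measurable_EFinP; apply: continuous_measurable_fun.
  exact: continuous_Im_expi.
- apply/measurable_EFinP; apply: continuous_measurable_fun.
  exact: continuous_Re_expi.
Qed.

Lemma fourier0 (nu : probability RM R) : fourier nu 0 = 1.
Proof.
rewrite /fourier; under eq_Rintegral do rewrite mul0r expi0.
under [X in (_ +i* X)%C]eq_Rintegral do rewrite mul0r expi0.
have nu_cst (a : R) : \int[nu]_(x in setT) a = a.
  by rewrite Rintegral_cst// [X in fine X](probability_setT nu) mulr1.
by rewrite !nu_cst.
Qed.

Lemma fourierN m (xi : R) : fourier m (- xi) = ((fourier m xi)^*)%C.
Proof.
apply/eqP; rewrite eq_complex; apply/andP; split; apply/eqP.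
  by apply: eq_Rintegral => x _; rewrite mulNr !Re_expi mulrN cosN.
transitivity (-1 * \int[m]_x Im (expi (xi * x))); last by rewrite mulN1r.
rewrite -RintegralZl//; last exact: integrable_Im_expi.
by apply: eq_Rintegral => x _; rewrite mulNr !Im_expi mulrN sinN mulN1r.
Qed.

(** The transform is continuous at 0, by dominated convergence, and has the
    value 1 there. *)
Lemma fourier_gt0 (nu : probability RM R) :
  exists2 d, 0 < d & forall xi, `|xi| < d -> 0 < normc (fourier nu xi) ^+ 2.
Proof.
pose f (xi x : R) := Re (expi (xi * x)).
have int_f xi : `]-1, 1[%classic xi -> nu.-integrable setT (EFin \o f xi).
  by move=> _; exact: integrable_Re_expi.
have cf : {ae nu, forall x, [set: RM] x ->
    {in `]-1, 1[%classic, continuous (f ^~ x)}}.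
  apply: aeW => x _ xi _; rewrite /f; under eq_fun do rewrite mulrC.
  exact: continuous_Re_expi.
have int_1 : nu.-integrable setT (EFin \o (cst 1 : R -> R)).
  apply: (@continuous_bounded_integrable _ nu (cst 1) 1) => x.
    exact: cvg_cst.
  by rewrite normr1.
have f_le1 xi : `]-1, 1[%classic xi ->
    {ae nu, forall x, [set: RM] x -> `|f xi x| <= cst 1 x}.
  by move=> _; apply: aeW => x _; exact: Re_expi_le1.
have in0 : (0 : R) \in `]-1, 1[%classic by rewrite inE /= in_itv /=; lra.
have c0 := continuity_under_integral measurableT int_f cf int_1 f_le1 in0.
have /nbhs_ballP[d d0 dF] : \forall xi \near 0, 0 < Re (fourier nu xi).
  apply: (cvgr_gt _ c0).
  have -> : \int[nu]_x f 0 x = 1 by exact: (congr1 (@complex.Re R) (fourier0 nu)).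
  exact: ltr01.
exists d => // xi xid; rewrite lt_def sqr_ge0 andbT.
apply/eqP => /normc_sqr_eq0 xi0.
have xi_d : ball 0 d xi by rewrite -ball_normE /ball_ /= sub0r normrN.
have : 0 < Re (fourier nu xi) := dF _ xi_d.
by rewrite xi0 ltxx.
Qed.

End fourier_transform.

(** * Orthogonal exponentials *)

Section orthogonality.
Variable R : realType.
Local Notation RM := (measurableTypeR R).
Local Notation C := R[i].
Local Notation normc := Normc.normc.
Local Notation Re := (@complex.Re R).
Local Notation Im := (@complex.Im R).

(** A trigonometric polynomial given by its coefficients and frequencies; the
    list may repeat frequencies, which makes products easy to write. *)
Definition trig (l : seq (C * R)) (x : R) : C :=
  \sum_(p <- l) p.1 * expi (p.2 * x).

Lemma trig_integral (m : {finite_measure set RM -> \bar R}) (l : seq (C * R)) :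
  [/\ m.-integrable setT (EFin \o (fun x => Re (trig l x))),
      m.-integrable setT (EFin \o (fun x => Im (trig l x))) &
      ((\int[m]_x Re (trig l x)) +i* (\int[m]_x Im (trig l x)))%C =
      \sum_(p <- l) p.1 * fourier m p.2].
Proof.
elim: l => [|p l [iRe iIm IH]].
  have -> : (fun x => Re (trig [::] x)) = cst 0.
    by apply/funext => x; rewrite /trig big_nil.
  have -> : (fun x => Im (trig [::] x)) = cst 0.
    by apply/funext => x; rewrite /trig big_nil.
  rewrite !Rintegral_cst// !mul0r big_nil.
  by split=> //; exact: (integrable0 m setT).
have ReE : (fun x => Re (trig (p :: l) x)) = (fun x =>
    (Re p.1 * Re (expi (p.2 * x)) + (- Im p.1) * Im (expi (p.2 * x))) +
    Re (trig l x)).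
  by apply/funext => x; rewrite /trig big_cons ReD ReM mulNr.
have ImE : (fun x => Im (trig (p :: l) x)) = (fun x =>
    (Re p.1 * Im (expi (p.2 * x)) + Im p.1 * Re (expi (p.2 * x))) +
    Im (trig l x)).
  by apply/funext => x; rewrite /trig big_cons ImD ImM.
have iR := integrable_Re_expi m p.2; have iI := integrable_Im_expi m p.2.
have i1 := integrable_add (integrable_scale (Re p.1) iR)
  (integrable_scale (- Im p.1) iI).
have i2 := integrable_add (integrable_scale (Re p.1) iI)
  (integrable_scale (Im p.1) iR).
rewrite ReE ImE; split; [exact: integrable_add|exact: integrable_add|].
rewrite !RintegralD//; try exact: integrable_scale.
rewrite !RintegralZl// big_cons -IH; apply/eqP; rewrite eq_complex.
rewrite ReD ImD ReM ImM; apply/andP; split; apply/eqP; congr (_ + _).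
by rewrite mulNr.
Qed.

Lemma normc_sqr_trig (l : seq (C * R)) (x : R) : normc (trig l x) ^+ 2 =
  Re (trig [seq (p.1 * (q.1^*)%C, p.2 - q.2) | p <- l, q <- l] x).
Proof.
have -> (z : C) : normc z ^+ 2 = Re (z * (z^*)%C) by rewrite -normc_sqrE.
congr Re; rewrite [in RHS]/trig big_allpairs_dep /= {1}/trig mulr_suml.
apply: eq_bigr => p _; rewrite /trig rmorph_sum mulr_sumr.
apply: eq_bigr => q _; rewrite rmorphM mulrACA mulrBl expiD; congr (_ * (_ * _)).
exact/esym/expiN.
Qed.

Lemma integral_normc_sqr_trig (m : {finite_measure set RM -> \bar R})
    (l : seq (C * R)) :
  (\int[m]_x (normc (trig l x) ^+ 2)%:E =
   (Re (\sum_(p <- l) \sum_(q <- l)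
      p.1 * (q.1^*)%C * fourier m (p.2 - q.2)))%:E)%E.
Proof.
set l2 := [seq (p.1 * (q.1^*)%C, p.2 - q.2) | p <- l, q <- l].
have [iRe _ E] := trig_integral m l2.
have := congr1 Re E; rewrite /l2 big_allpairs_dep => <- /=.
under eq_integral do rewrite normc_sqr_trig.
by rewrite /Rintegral fineK//; exact: integrable_fin_num.
Qed.

Lemma complete_square (z w : C) :
  1 * ((- w)^*)%C * z + (- w * (z^*)%C + w * (w^*)%C) =
  - (z * (z^*)%C) + (z - w) * ((z - w)^*)%C.
Proof. rewrite rmorphN rmorphB /=; ring. Qed.

(** The coefficients and frequencies of the difference between the exponential of
    frequency xi and a linear combination of those with frequencies in s. *)
Definition combination_error (s : seq R) (c : R -> C) (xi : R) : seq (C * R) :=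
  (1, xi) :: [seq (- c y, y) | y <- s].

(** Completing the square.  The choice c y = F (xi - y), which cancels the last
    sum, gives Bessel's inequality; leaving that sum out gives a lower bound for
    the distance of an exponential to the span of an orthonormal family. *)
Lemma quadratic_form_expansion (F : R -> C) (s : seq R) (c : R -> C) (xi : R) :
  F 0 = 1 -> (forall x, F (- x) = ((F x)^*)%C) -> uniq s ->
  {in s &, forall x y, x <> y -> F (x - y) = 0} ->
  Re (\sum_(p <- combination_error s c xi) \sum_(q <- combination_error s c xi)
      p.1 * (q.1^*)%C * F (p.2 - q.2)) =
  1 - \sum_(y <- s) normc (F (xi - y)) ^+ 2 +
    \sum_(y <- s) normc (F (xi - y) - c y) ^+ 2.
Proof.
move=> F0 FN us s_null; rewrite /combination_error.
have -> : \sum_(p <- (1, xi) :: [seq (- c y, y) | y <- s])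
      \sum_(q <- (1, xi) :: [seq (- c y, y) | y <- s])
        p.1 * (q.1^*)%C * F (p.2 - q.2) =
    1 + \sum_(y <- s) 1 * ((- c y)^*)%C * F (xi - y) +
    \sum_(y <- s) ((- c y) * (1^*)%C * F (y - xi) +
      \sum_(z <- s) (- c y) * ((- c z)^*)%C * F (y - z)).
  rewrite big_cons big_cons !big_map; congr (_ + _ + _).
    by rewrite subrr F0 conjc1 !mulr1.
  by apply: eq_bigr => y _; rewrite big_cons big_map.
pose a y := F (xi - y).
have diag : \sum_(y <- s) ((- c y) * (1^*)%C * F (y - xi) +
      \sum_(z <- s) (- c y) * ((- c z)^*)%C * F (y - z)) =
    \sum_(y <- s) (- c y * ((a y)^*)%C + c y * ((c y)^*)%C).
  apply: eq_big_seq => y ys; rewrite conjc1 mulr1 -FN opprB.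
  congr (_ + _); rewrite (bigD1_seq y)//= [X in _ + X]big1_seq ?addr0.
    by rewrite subrr F0 rmorphN mulrNN mulr1.
  by move=> z /andP[zy zs]; rewrite s_null ?mulr0//; apply/nesym/eqP.
rewrite diag.
have -> : 1 + \sum_(y <- s) 1 * ((- c y)^*)%C * F (xi - y) +
    \sum_(y <- s) (- c y * ((a y)^*)%C + c y * ((c y)^*)%C) =
  1 - \sum_(y <- s) (normc (a y) ^+ 2)%:C%C +
    \sum_(y <- s) (normc (a y - c y) ^+ 2)%:C%C.
  rewrite -!addrA; congr (_ + _).
  rewrite -sumrN -!big_split; apply: eq_bigr => y _ /=.
  by rewrite !normc_sqrE complete_square.
have Re_sumC (G : R -> R) : Re (\sum_(y <- s) (G y)%:C%C) = \sum_(y <- s) G y.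
  by rewrite (big_morph Re (@ReD R) (erefl _)).
by rewrite !ReD ReN !Re_sumC.
Qed.

Lemma integral_normc_sqr_expansion (nu : probability RM R) (s : seq R)
    (c : R -> C) (xi : R) : uniq s ->
  {in s &, forall x y, x <> y -> fourier nu (x - y) = 0} ->
  (\int[nu]_x (normc (expi (xi * x) - \sum_(y <- s) c y * expi (y * x)) ^+ 2)%:E =
   (1 - \sum_(y <- s) normc (fourier nu (xi - y)) ^+ 2 +
    \sum_(y <- s) normc (fourier nu (xi - y) - c y) ^+ 2)%:E)%E.
Proof.
move=> us s_null.
have lE x : expi (xi * x) - \sum_(y <- s) c y * expi (y * x) =
    trig (combination_error s c xi) x.
  rewrite /trig big_cons mul1r big_map -sumrN; congr (_ + _).
  by apply: eq_bigr => y _; rewrite mulNr.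
under eq_integral do rewrite lE.
rewrite integral_normc_sqr_trig quadratic_form_expansion//; first exact: fourier0.
by move=> x; exact: fourierN.
Qed.

Lemma fourier_bessel (nu : probability RM R) :
  bessel (fun x => normc (fourier nu x) ^+ 2).
Proof.
move=> s us s_null xi.
have s0 : {in s &, forall x y, x <> y -> fourier nu (x - y) = 0}.
  by move=> x y xs ys xy; apply: normc_sqr_eq0; exact: s_null.
have := @integral_normc_sqr_expansion nu s (fun y => fourier nu (xi - y)) xi us s0.
rewrite [X in (_ + X)%R]big1 => [|y _]; last first.
  by rewrite subrr Normc.normc0 expr0n.
move=> E; have : (0 <= (1 - \sum_(y <- s) normc (fourier nu (xi - y)) ^+ 2 + 0)%:E)%E.
  by rewrite -E; apply: integral_ge0 => x _; rewrite lee_fin sqr_ge0.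
by rewrite lee_fin addr0 subr_ge0.
Qed.

Lemma inner_expo (nu : probability RM R) (x y : R) :
  inner nu (expo x) (expo y) = fourier nu (x - y).
Proof.
have E t : expo x t * ((expo y t)^*)%C = expi ((x - y) * t).
  by rewrite !expoE -expiN -expiD -mulrBl.
rewrite /inner /complex_integral /fourier.
by congr (_ +i* _)%C; apply: eq_Rintegral => t _; rewrite E.
Qed.

(** Approximating the exponential of frequency xi within e by a combination of
    the basis forces the sum of its squared coefficients to exceed 1 - e. *)
Lemma spectral_spectrum (mu : probability RM R) : spectral_measure mu ->
  exists L, spectrum (fun x => normc (fourier mu x) ^+ 2) L.
Proof.
move=> [L [cL [_ Lon Ldense]]]; exists L.
have L0 x y : L x -> L y -> x <> y -> fourier mu (x - y) = 0.
  by move=> Lx Ly xy; rewrite -inner_expo Lon//; case: eqP.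
split=> //.
  by move=> x y Lx Ly xy; rewrite L0// Normc.normc0 expr0n.
exists set0 => // xi _ e e0.
have exi_L2 : in_L2 mu (expo xi).
  split.
  - under eq_fun do rewrite expoE; apply: continuous_measurable_fun.
    exact: continuous_Re_expi.
  - under eq_fun do rewrite expoE; apply: continuous_measurable_fun.
    exact: continuous_Im_expi.
  - rewrite /sq_norm; under eq_integral do rewrite expoE normc_expi expr1n.
    by rewrite integral_cst// [X in (_ * X)%E](probability_setT mu) mule1 ltry.
have [s [c [sL]]] := Ldense _ exi_L2 _ e0.
(* The list s may have repetitions: the coefficients of equal indices are added
   up to get a combination over distinct indices. *)
pose s' := undup s; pose c' y := c y *+ count_mem y s.
have s'0 : {in s' &, forall x y, x <> y -> fourier mu (x - y) = 0}.
  by move=> x y; rewrite !mem_undup => /sL Lx /sL Ly; exact: L0.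
have sumE x : \sum_(i <- s) c i * expo i x = \sum_(y <- s') c' y * expi (y * x).
  rewrite -[LHS]big_undup_iterop_count; apply: eq_bigr => y _.
  by rewrite -[LHS]/((c y * expo y x) *+ count_mem y s) expoE /c' mulrnAl.
rewrite /sq_norm; under eq_integral do rewrite sumE expoE.
rewrite integral_normc_sqr_expansion ?undup_uniq// lte_fin => lt_e.
exists s'; split; first exact: undup_uniq.
  by move=> x; rewrite mem_undup => /sL.
have := @sumr_ge0 _ _ s' xpredT (fun y => normc (fourier mu (xi - y) - c' y) ^+ 2)
  (fun _ _ => sqr_ge0 _).
lra.
Qed.

End orthogonality.

(** * The refinement equation and the divisibility theorem *)

Section refinement.
Variable R : realType.
Local Notation RM := (measurableTypeR R).
Local Notation C := R[i].
Local Notation normc := Normc.normc.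
Variables (N : nat -> nat) (B : nat -> {fset int}).
Hypothesis N_gt0 : forall k, (1 <= k)%N -> (0 < N k)%N.

Lemma prodN_neq0 k n : \prod_(k.+1 <= i < n) (N i)%:R != 0 :> R.
Proof.
rewrite big_nat; apply: (big_ind (fun x => x != 0)) => [|x y|i /andP[ki _]].
- exact: oner_neq0.
- exact: mulf_neq0.
- by rewrite pnatr_eq0 -lt0n N_gt0// (leq_trans _ ki).
Qed.

Lemma fourier_tailS k n (xi : R) :
  fourier (tail_convolution N B k n.+1) xi =
  fourier (tail_convolution N B k n) xi *
  mask_poly (B (k + n.+1)) (xi / \prod_(k.+1 <= i < (k + n.+1).+1) (N i)%:R).
Proof. by rewrite /= fourier_convolution fourier_uniform_on ?prodN_neq0. Qed.

(** The finite convolutions are defined by adding a last factor, whereas the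
    refinement equation takes out the first one. *)
Lemma fourier_tail_head k n (xi : R) :
  fourier (tail_convolution N B k n.+1) xi =
  mask_poly (B k.+1) (xi / (N k.+1)%:R) *
  fourier (tail_convolution N B k.+1 n) (xi / (N k.+1)%:R).
Proof.
elim: n => [|n IH].
  rewrite fourier_tailS [tail_convolution _ _ _ 0]/= !fourier_dirac0.
  by rewrite mul1r mulr1 addn1 big_nat1.
rewrite fourier_tailS IH [in RHS]fourier_tailS -mulrA addSnnS.
rewrite [\prod_(k.+1 <= i < _) _]big_ltn; first by rewrite invfM !mulrA.
by rewrite ltnS addnS ltnS leq_addr.
Qed.

Lemma weak_cvg_fourier (m : nat -> {finite_measure set RM -> \bar R})
    (nu : probability RM R) (xi : R) : weak_cvg m nu ->
  complex.Re (fourier (m n) xi) @[n --> \oo] --> complex.Re (fourier nu xi) /\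
  complex.Im (fourier (m n) xi) @[n --> \oo] --> complex.Im (fourier nu xi).
Proof.
move=> mnu; split; apply: mnu.
- exact: continuous_Re_expi.
- by exists 1 => x; exact: Re_expi_le1.
- exact: continuous_Im_expi.
- by exists 1 => x; exact: Im_expi_le1.
Qed.

Lemma fourier_refinement k (nu nu' : probability RM R) (xi : R) :
  is_tail_measure N B k nu -> is_tail_measure N B k.+1 nu' ->
  fourier nu xi = mask_poly (B k.+1) (xi / (N k.+1)%:R) *
    fourier nu' (xi / (N k.+1)%:R).
Proof.
move=> cnu cnu'; have [cRe cIm] := weak_cvg_fourier xi cnu.
have [cRe' cIm'] := weak_cvg_fourier (xi / (N k.+1)%:R) cnu'.
have sE n := fourier_tail_head k n xi.
move: (mask_poly _ _) sE => w sE.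
set F := fun n => fourier (tail_convolution N B k n) xi.
set G := fun n => fourier (tail_convolution N B k.+1 n) (xi / (N k.+1)%:R).
have ReE : (fun n => complex.Re (F n.+1)) = (fun n =>
    complex.Re w * complex.Re (G n) - complex.Im w * complex.Im (G n)).
  by apply/funext => n; rewrite /F sE ReM.
have ImE : (fun n => complex.Im (F n.+1)) = (fun n =>
    complex.Re w * complex.Im (G n) + complex.Im w * complex.Re (G n)).
  by apply/funext => n; rewrite /F sE ImM.
apply/eqP; rewrite eq_complex ReM ImM; apply/andP; split; apply/eqP.
- move: cRe; rewrite -cvg_shiftS => cRe.
  refine (cvg_unique (@Rhausdorff R) cRe _).
  rewrite [X in X @ _](ReE).
  exact: cvgB (cvgM (cvg_cst _) cRe') (cvgM (cvg_cst _) cIm').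
- move: cIm; rewrite -cvg_shiftS => cIm.
  refine (cvg_unique (@Rhausdorff R) cIm _).
  rewrite [X in X @ _](ImE).
  exact: cvgD (cvgM (cvg_cst _) cIm') (cvgM (cvg_cst _) cRe').
Qed.

End refinement.

Section rescaling.
Variable R : realType.

Lemma bessel_scale (g : R -> R) (c : R) : c != 0 -> bessel g ->
  bessel (fun x => g (x / c)).
Proof.
move=> c0 gB s us s_null xi.
have := gB [seq x / c | x <- s]; rewrite map_inj_uniq; last first.
  exact: mulIf (invr_neq0 c0).
move=> /(_ us) gBs; have := gBs _ (xi / c); rewrite big_map.
under eq_bigr do rewrite -mulrBl.
apply => x y /= /mapP[x' x's ->] /mapP[y' y's ->] xy.
rewrite -mulrBl; apply: s_null => // x'y'; apply: xy; by rewrite x'y'.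
Qed.

Lemma mask_crs (B : {fset int}) (M n : nat) (P : R) : 0 < P -> (0 < M)%N ->
  complete_residue_system B M -> (4 * n + 2 %| M)%N ->
  character_polynomial B = tofrac (\sum_(0 <= i < (2 * n).+1) (- 'X) ^+ i) ->
  mask (P / M%:R) M.-1 (fun x => Normc.normc (mask_poly B (x / P)) ^+ 2).
Proof.
move=> P0 M0 BM nM Bf; have [BM' _] := BM.
have P0' : P != 0 by rewrite gt_eqF.
have M0' : M%:R != 0 :> R by rewrite pnatr_eq0 -lt0n.
split.
- by move=> x; exact: sqr_ge0.
- move=> x z; rewrite prednK// divfK// -(mask_poly_shift B (x / P) z).
  by congr (Normc.normc (mask_poly _ _) ^+ 2); field.
- rewrite mul0r mask_poly0 ?BM'// Normc.normc1 expr1n; apply/eqP; exact: oner_neq0.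
- move=> x /normc_sqr_eq0 /(mask_poly_zero M0 BM' nM Bf)[z zE].
  by exists z; rewrite -zE; field; rewrite M0' P0'.
- move=> x; rewrite prednK// -[RHS](crs_sum_sqr (x / P) M0 BM).
  apply: eq_bigr => j _; congr (Normc.normc (mask_poly _ _) ^+ 2).
  by field; rewrite M0' P0'.
Qed.

End rescaling.

Theorem corollary2p5 (R : realType)
  (N M : nat -> nat) (B : nat -> {fset int}) (n : nat -> nat)
  (mu : probability (measurableTypeR R) R)
  (nu : nat -> probability (measurableTypeR R) R)
  (hM : forall k, (1 <= k)%N -> (2 <= M k)%N)
  (hN : forall k, (1 <= k)%N -> (M k <= N k)%N)
  (hB : forall k, (1 <= k)%N -> complete_residue_system (B k) (M k))
  (hf : forall k, (1 <= k)%N ->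
     character_polynomial (B k) =
       tofrac (\sum_(0 <= i < (2 * n k).+1) (- 'X) ^+ i))
  (hn : forall k, (1 <= k)%N -> (4 * n k + 2 %| M k)%N)
  (hmu : is_infinite_convolution N B mu)
  (hnu : forall k, (1 <= k)%N -> is_tail_measure N B k (nu k))
  (htight : tight [set nu k | k in [set k : nat | (1 <= k)%N]])
  (hspec : spectral_measure mu) :
  forall k, (2 <= k)%N -> (M k %| N k)%N.
Proof.
have M_gt0 k : (0 < M k.+1)%N by apply: leq_trans (hM k.+1 isT).
have N_gt0 k : (1 <= k)%N -> (0 < N k)%N.
  by move=> k1; apply: leq_trans (hN k k1); apply: leq_trans (hM k k1).
pose tail k := if k is 0%N then mu else nu k.
have tailE k : is_tail_measure N B k (tail k).
  by case: k => [|k]; [exact: hmu|exact: hnu].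
pose P k : R := \prod_(1 <= i < k.+1) (N i)%:R.
have P_gt0 k : 0 < P k.
  by rewrite lt_def prodN_neq0//= prodr_ge0.
have P_neq0 k : P k != 0 by rewrite gt_eqF.
have PS k : P k.+1 = P k * (N k.+1)%:R by rewrite /P big_nat_recr.
pose h k := P k.+1 / (M k.+1)%:R.
have h_gt0 k : 0 < h k by rewrite divr_gt0 ?ltr0n.
pose u k x := Normc.normc (mask_poly (B k.+1) (x / P k.+1)) ^+ 2.
have u_mask k : mask (h k) (M k.+1).-1 (u k).
  by apply: (mask_crs (P_gt0 k.+1) (M_gt0 k)); [exact: hB|exact: hn|exact: hf].
pose g k x := Normc.normc (fourier (tail k) (x / P k)) ^+ 2.
have g_ge0 k x : 0 <= g k x by exact: sqr_ge0.
have g_bessel k : bessel (g k).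
  by have := bessel_scale (P_neq0 k) (@fourier_bessel R (tail k)).
have g_gt0 k : exists2 d, 0 < d & forall x, `|x| < d -> 0 < g k x.
  have [d d0 gd] := fourier_gt0 (tail k).
  exists (d * P k) => [|x xd]; first by rewrite mulr_gt0.
  by apply: gd; rewrite normrM normfV (gtr0_norm (P_gt0 k)) ltr_pdivrMr.
have gS k x : g k x = u k x * g k.+1 x.
  rewrite /g (fourier_refinement N_gt0 _ (tailE k) (tailE k.+1)) Normc.normcM.
  by rewrite exprMn /u PS invfM [x * (_ * _)]mulrA.
have [L sL] := spectral_spectrum hspec.
have sL0 : spectrum (g 0%N) L.
  rewrite (_ : g 0%N = fun x => Normc.normc (fourier mu x) ^+ 2)//.
  by apply/funext => x; rewrite /g /P big_geq// divr1.
case=> [|[|k]]// _.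
have [L' sL'] := spectrum_chain h_gt0 u_mask g_ge0 g_bessel gS sL0 k.
have hP j : h j * (M j.+1).-1.+1%:R = P j.+1.
  by rewrite prednK// divfK// pnatr_eq0 -lt0n.
have m_gt0 : (0 < (M k.+1).-1)%N by rewrite -ltnS prednK// hM.
have [|z hz] := spectrum_two_steps (h_gt0 k) (h_gt0 k.+1) m_gt0 (u_mask k)
  (u_mask k.+1) (g_ge0 k.+1) (g_bessel k.+1) (g_ge0 k.+2) (g_bessel k.+2)
  (g_gt0 k.+2) (gS k) (gS k.+1) (n := N k.+2) sL'.
  by rewrite !hP PS.
have NM : (N k.+2)%:Z = z * (M k.+2)%:Z.
  apply: (@intr_inj R); rewrite intrM; apply: (mulfI (P_neq0 k.+1)).
  move: hz; rewrite hP /h PS => /(canRL (divfK _)) -> //.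
    by rewrite mulrA.
  by rewrite pnatr_eq0 -lt0n.
have : ((M k.+2)%:Z %| (N k.+2)%:Z)%Z by rewrite NM dvdz_mull.
by rewrite dvdzE.
Qed.
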